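(* Let $\mathcal{C}$ be a codifferential category with finite coproducts, let $(A,\alpha)$ be a $T$-algebra in $\mathcal{C}$ and let $M$ be an $A$-module (a module over the commutative algebra associated to $(A,\alpha)$). Then the commutative algebra structure associated to the $T$-algebra $W(A,M)=(A\oplus M,\beta^{AM})$ coincides with the commutative algebra structure on $A\oplus M$ whose multiplication $(A\oplus M)\otimes(A\oplus M)\to A\oplus M$ has first component $(\pi_1\otimes\pi_1);m_A$ and second component $(\pi_1\otimes\pi_2);\bullet_M + c;(\pi_1\otimes\pi_2);\bullet_M$, and whose unit is $\langle e_A,0\rangle:k\to A\oplus M$.
   Context: Composition is written in diagrammatic order: $f;g$ means first $f$, then $g$. Monoidal structures are written as if strict, with unit $k$ and symmetry $c$. An additive symmetric monoidal category is a symmetric monoidal category enriched over commutative monoids (hom-sets have addition and zero, composition is bilinear) whose tensor functor is additive in both variables. In such a category finite coproducts are biproducts, written $\oplus$, with projections $\pi_1,\pi_2$ and pairing $\langle f,g\rangle$. A commutative algebra is a commutative monoid object; modules are left modules, with action $\bullet_M:A\otimes M\to M$. An algebra modality on a symmetric monoidal category consists of a monad $(T,\mu,\eta)$ and, for each object $C$, morphisms $m:TC\otimes TC\to TC$, $e:k\to TC$ making $TC$ a commutative algebra, such that $m,e$ are natural in $C$ (each $Tf$ is an algebra homomorphism) and each $\mu_C:T^2C\to TC$ is an algebra homomorphism. A codifferential category is an additive symmetric monoidal category with an algebra modality $T$ and a deriving transform, i.e. a transformation $d_{TC}:TC\to TC\otimes C$, natural in $C$, such that: (d1) $e;d=0$;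 (d2) $m;d=(1\otimes d);(m\otimes 1)+(d\otimes 1);c;(m\otimes 1)$, where $c$ here is the symmetry $TC\otimes C\otimes TC\to TC\otimes TC\otimes C$; (d3) $\eta;d=e\otimes 1$; (d4) $\mu_C;d_{TC}=d_{T^2C};(\mu_C\otimes d_{TC});(m\otimes 1_C)$. Each $T$-algebra $(A,\alpha)$ has an associated commutative algebra structure with multiplication $m_A=(\eta_A\otimes\eta_A);m;\alpha$ and unit $e_A=e;\alpha$. For a $T$-algebra $(A,\alpha)$ and an $A$-module $M$, $W(A,M)$ is the $T$-algebra $(A\oplus M,\beta^{AM})$ with $\beta^{AM}=\langle\beta_1,\beta_2\rangle:T(A\oplus M)\to A\oplus M$, $\beta_1=T\pi_1;\alpha$ and $\beta_2=d_{T(A\oplus M)};(T\pi_1\otimes\pi_2);(\alpha\otimes 1_M);\bullet_M$. *)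

(* Defs.v *)
(* Hom-sets are plain types with Leibniz equality, so that no decidability or
   choice is imposed on them (as [nmodType] would do).  Monoidal structures are
   not assumed strict: coherence isomorphisms are inserted wherever a formula
   written as if strict needs them.  Composition is diagrammatic:
   [f ;; g] is first [f], then [g]. *)
From mathcomp Require Import ssreflect ssrfun.
From Stdlib Require Import ProofIrrelevance.

Set Implicit Arguments.
Unset Strict Implicit.
Unset Printing Implicit Defensive.

Declare Scope cat_scope.
Delimit Scope cat_scope with cat.
Open Scope cat_scope.

Record category := Category {
  ob :> Type;
  hom : ob -> ob -> Type;
  idm : forall X, hom X X;
  comp : forall X Y Z, hom X Y -> hom Y Z -> hom X Z;
  comp_idl : forall X Y (f : hom X Y), comp (idm X) f = f;
  comp_idr : forall X Y (f : hom X Y), comp f (idm Y) = f;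
  comp_assoc : forall X Y Z W (f : hom X Y) (g : hom Y Z) (h : hom Z W),
    comp f (comp g h) = comp (comp f g) h
}.

Arguments hom {_} _ _.
Arguments idm {_} X.
Arguments comp {_ X Y Z} f g.

Notation "f ;; g" := (comp f g)
  (at level 45, left associativity, format "f  ;;  g") : cat_scope.

Record symMonCat := SymMonCat {
  smc_cat :> category;
  tens : smc_cat -> smc_cat -> smc_cat;
  tensm : forall X X' Y Y' : smc_cat,
    hom X X' -> hom Y Y' -> hom (tens X Y) (tens X' Y');
  unitob : smc_cat;
  tensm_id : forall X Y, tensm (idm X) (idm Y) = idm (tens X Y);
  tensm_comp : forall X1 X2 X3 Y1 Y2 Y3
      (f : hom X1 X2) (f' : hom X2 X3) (g : hom Y1 Y2) (g' : hom Y2 Y3),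
    tensm (f ;; f') (g ;; g') = tensm f g ;; tensm f' g';
  asc : forall X Y Z, hom (tens (tens X Y) Z) (tens X (tens Y Z));
  ascV : forall X Y Z, hom (tens X (tens Y Z)) (tens (tens X Y) Z);
  lun : forall X, hom (tens unitob X) X;
  lunV : forall X, hom X (tens unitob X);
  run : forall X, hom (tens X unitob) X;
  runV : forall X, hom X (tens X unitob);
  sym : forall X Y, hom (tens X Y) (tens Y X);
  ascK : forall X Y Z, asc X Y Z ;; ascV X Y Z = idm _;
  ascVK : forall X Y Z, ascV X Y Z ;; asc X Y Z = idm _;
  lunK : forall X, lun X ;; lunV X = idm _;
  lunVK : forall X, lunV X ;; lun X = idm _;
  runK : forall X, run X ;; runV X = idm _;
  runVK : forall X, runV X ;; run X = idm _;
  symK : forall X Y, sym X Y ;; sym Y X = idm _;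
  asc_nat : forall X X' Y Y' Z Z' (f : hom X X') (g : hom Y Y') (h : hom Z Z'),
    tensm (tensm f g) h ;; asc X' Y' Z' = asc X Y Z ;; tensm f (tensm g h);
  lun_nat : forall X Y (f : hom X Y),
    tensm (idm unitob) f ;; lun Y = lun X ;; f;
  run_nat : forall X Y (f : hom X Y),
    tensm f (idm unitob) ;; run Y = run X ;; f;
  sym_nat : forall X X' Y Y' (f : hom X X') (g : hom Y Y'),
    tensm f g ;; sym X' Y' = sym X Y ;; tensm g f;
  pentagon : forall X Y Z W,
    tensm (asc X Y Z) (idm W) ;; asc X (tens Y Z) W ;; tensm (idm X) (asc Y Z W)
      = asc (tens X Y) Z W ;; asc X Y (tens Z W);
  triangle : forall X Y,
    asc X unitob Y ;; tensm (idm X) (lun Y) = tensm (run X) (idm Y);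
  hexagon : forall X Y Z,
    asc X Y Z ;; sym X (tens Y Z) ;; asc Y Z X
      = tensm (sym X Y) (idm Z) ;; asc Y X Z ;; tensm (idm Y) (sym X Z);
  (* Follows from the other axioms. *)
  sym_lun : forall X, sym X unitob ;; lun X = run X
}.

Arguments tens {_} X Y.
Arguments tensm {_ X X' Y Y'} f g.
Arguments unitob {_}.
Arguments asc {_} X Y Z.
Arguments ascV {_} X Y Z.
Arguments lun {_} X.
Arguments lunV {_} X.
Arguments run {_} X.
Arguments runV {_} X.
Arguments sym {_} X Y.

Notation "X ⊗ Y" := (tens X Y) (at level 40, left associativity) : cat_scope.
Notation "f ⊗₁ g" := (tensm f g) (at level 40, left associativity) : cat_scope.

Record commAlg (C : symMonCat) (X : C) := CommAlg {
  mul : hom (X ⊗ X) X;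
  one : hom unitob X;
  mul_assoc :
    (mul ⊗₁ idm X) ;; mul = asc X X X ;; (idm X ⊗₁ mul) ;; mul;
  mul_onel : (one ⊗₁ idm X) ;; mul = lun X;
  mul_oner : (idm X ⊗₁ one) ;; mul = run X;
  mul_comm : sym X X ;; mul = mul
}.

Definition alg_hom (C : symMonCat) (X Y : C) (A : commAlg X) (B : commAlg Y)
    (f : hom X Y) : Prop :=
  mul A ;; f = (f ⊗₁ f) ;; mul B /\ one A ;; f = one B.

Record lmodule (C : symMonCat) (X : C) (A : commAlg X) := LModule {
  lmod_ob :> C;
  act : hom (X ⊗ lmod_ob) lmod_ob;
  act_mul : (mul A ⊗₁ idm lmod_ob) ;; act
              = asc X X lmod_ob ;; (idm X ⊗₁ act) ;; act;
  act_one : (one A ⊗₁ idm lmod_ob) ;; act = lun lmod_ob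
}.

Arguments act {_ _ _} M : rename.

Record addSMC := AddSMC {
  addsmc_smc :> symMonCat;
  addm : forall X Y : addsmc_smc, hom X Y -> hom X Y -> hom X Y;
  zerom : forall X Y : addsmc_smc, hom X Y;
  addm_assoc : forall X Y, associative (@addm X Y);
  addm_comm : forall X Y, commutative (@addm X Y);
  add0m : forall X Y, left_id (zerom X Y) (@addm X Y);
  comp_addl : forall X Y Z (f g : hom X Y) (h : hom Y Z),
    addm f g ;; h = addm (f ;; h) (g ;; h);
  comp_addr : forall X Y Z (f : hom X Y) (g h : hom Y Z),
    f ;; addm g h = addm (f ;; g) (f ;; h);
  comp_0l : forall X Y Z (h : hom Y Z), zerom X Y ;; h = zerom X Z;
  comp_0r : forall X Y Z (f : hom X Y), f ;; zerom Y Z = zerom X Z;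
  tens_addl : forall X X' Y Y' (f g : hom X X') (h : hom Y Y'),
    (addm f g) ⊗₁ h = addm (f ⊗₁ h) (g ⊗₁ h);
  tens_addr : forall X X' Y Y' (f : hom X X') (g h : hom Y Y'),
    f ⊗₁ (addm g h) = addm (f ⊗₁ g) (f ⊗₁ h);
  tens_0l : forall X X' Y Y' (h : hom Y Y'),
    zerom X X' ⊗₁ h = zerom (X ⊗ Y) (X' ⊗ Y');
  tens_0r : forall X X' Y Y' (f : hom X X'),
    f ⊗₁ zerom Y Y' = zerom (X ⊗ Y) (X' ⊗ Y')
}.

Arguments addm {_ X Y} f g.
Arguments zerom {_} X Y.

Notation "f + g" := (addm f g) : cat_scope.

Record monad (C : category) := Monad {
  T :> C -> C;
  Tm : forall X Y, hom X Y -> hom (T X) (T Y);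
  Tm_id : forall X, Tm (idm X) = idm (T X);
  Tm_comp : forall X Y Z (f : hom X Y) (g : hom Y Z),
    Tm (f ;; g) = Tm f ;; Tm g;
  eta : forall X, hom X (T X);
  mu : forall X, hom (T (T X)) (T X);
  eta_nat : forall X Y (f : hom X Y), f ;; eta Y = eta X ;; Tm f;
  mu_nat : forall X Y (f : hom X Y), Tm (Tm f) ;; mu Y = mu X ;; Tm f;
  eta_mu : forall X, eta (T X) ;; mu X = idm _;
  Teta_mu : forall X, Tm (eta X) ;; mu X = idm _;
  mu_mu : forall X, mu (T X) ;; mu X = Tm (mu X) ;; mu X
}.

Arguments Tm {_} m {X Y} f : rename.

Record algModality (C : symMonCat) := AlgModality {
  am_monad :> monad C;
  freeAlg : forall X, commAlg (am_monad X);
  Tm_hom : forall X Y (f : hom X Y),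
    alg_hom (freeAlg X) (freeAlg Y) (Tm am_monad f);
  mu_hom : forall X, alg_hom (freeAlg (am_monad X)) (freeAlg X) (mu am_monad X)
}.

(* [der X] is d_{TX} : TX -> TX ⊗ X.  In the Leibniz rule the symmetry
   exchanges the last two factors of TX ⊗ X ⊗ TX. *)
Record derivingTransform (C : addSMC) (S : algModality C) := DerivingTransform {
  der : forall X : C, hom (S X) (S X ⊗ X);
  der_nat : forall X Y (f : hom X Y),
    Tm S f ;; der Y = der X ;; (Tm S f ⊗₁ f);
  der_one : forall X, one (freeAlg S X) ;; der X = zerom _ _;
  der_mul : forall X,
    mul (freeAlg S X) ;; der X
      = (idm _ ⊗₁ der X) ;; ascV _ _ _ ;; (mul (freeAlg S X) ⊗₁ idm X)
        + (der X ⊗₁ idm _)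
            ;; (asc _ _ _ ;; (idm _ ⊗₁ sym _ _) ;; ascV _ _ _)
            ;; (mul (freeAlg S X) ⊗₁ idm X);
  der_eta : forall X,
    eta S X ;; der X = lunV X ;; (one (freeAlg S X) ⊗₁ idm X);
  der_mu : forall X,
    mu S X ;; der X
      = der (S X) ;; (mu S X ⊗₁ der X) ;; ascV _ _ _
          ;; (mul (freeAlg S X) ⊗₁ idm X)
}.

Record codiffCat := CodiffCat {
  codiff_smc :> addSMC;
  modality : algModality codiff_smc;
  deriv : derivingTransform modality
}.

Arguments modality {_}.
Arguments deriv {_}.

Record finCoproducts (C : category) := FinCoproducts {
  initob : C;
  initm : forall X, hom initob X;
  initm_uniq : forall X (f : hom initob X), f = initm X;
  coprod : C -> C -> C;
  inj1 : forall X Y, hom X (coprod X Y);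
  inj2 : forall X Y, hom Y (coprod X Y);
  copair : forall X Y Z, hom X Z -> hom Y Z -> hom (coprod X Y) Z;
  inj1_copair : forall X Y Z (f : hom X Z) (g : hom Y Z),
    inj1 X Y ;; copair f g = f;
  inj2_copair : forall X Y Z (f : hom X Z) (g : hom Y Z),
    inj2 X Y ;; copair f g = g;
  copair_uniq : forall X Y Z (h : hom (coprod X Y) Z),
    h = copair (inj1 X Y ;; h) (inj2 X Y ;; h)
}.

Arguments coprod {_} F X Y : rename.
Arguments inj1 {_} F X Y : rename.
Arguments inj2 {_} F X Y : rename.
Arguments copair {_} F {X Y Z} f g : rename.

(* The projections and the pairing are those induced by the coproduct and the
   zero maps; [bipair_proj1], [bipair_proj2] and [bipair_uniq] are the universal
   property of the product. *)
Section Biproducts.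
Variables (C : addSMC) (F : finCoproducts C).

Definition biproj1 (X Y : C) : hom (coprod F X Y) X :=
  copair F (idm X) (zerom Y X).

Definition biproj2 (X Y : C) : hom (coprod F X Y) Y :=
  copair F (zerom X Y) (idm Y).

Definition bipair (Z X Y : C) (f : hom Z X) (g : hom Z Y) :
    hom Z (coprod F X Y) :=
  f ;; inj1 F X Y + g ;; inj2 F X Y.

Lemma addm0 (X Y : C) (f : hom X Y) : f + zerom X Y = f.
Proof. by rewrite addm_comm add0m. Qed.

Lemma bipair_proj1 Z X Y (f : hom Z X) (g : hom Z Y) :
  bipair f g ;; biproj1 X Y = f.
Proof.
by rewrite /bipair /biproj1 comp_addl -!comp_assoc inj1_copair inj2_copair comp_idr
           comp_0r addm0.
Qed.

Lemma bipair_proj2 Z X Y (f : hom Z X) (g : hom Z Y) :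
  bipair f g ;; biproj2 X Y = g.
Proof.
by rewrite /bipair /biproj2 comp_addl -!comp_assoc inj1_copair inj2_copair comp_idr
           comp_0r add0m.
Qed.

Lemma bipair_proj X Y : bipair (biproj1 X Y) (biproj2 X Y) = idm (coprod F X Y).
Proof.
rewrite (copair_uniq (bipair _ _)) (copair_uniq (idm _)) /bipair /biproj1 /biproj2.
by rewrite !comp_addr !comp_assoc !inj1_copair !inj2_copair !comp_0l !comp_idl
           !comp_idr addm0 add0m.
Qed.

Lemma bipair_uniq Z X Y (h : hom Z (coprod F X Y)) :
  h = bipair (h ;; biproj1 X Y) (h ;; biproj2 X Y).
Proof. by rewrite /bipair -!comp_assoc -comp_addr -/(bipair _ _) bipair_proj comp_idr. Qed.

Lemma bipair_ext Z X Y (h h' : hom Z (coprod F X Y)) :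
  h ;; biproj1 X Y = h' ;; biproj1 X Y -> h ;; biproj2 X Y = h' ;; biproj2 X Y -> h = h'.
Proof. by move=> e1 e2; rewrite (bipair_uniq h) (bipair_uniq h') e1 e2. Qed.

Lemma comp_bipair W Z X Y (k : hom W Z) (f : hom Z X) (g : hom Z Y) :
  k ;; bipair f g = bipair (k ;; f) (k ;; g).
Proof. by rewrite /bipair comp_addr !comp_assoc. Qed.

End Biproducts.

Arguments biproj1 {_} F X Y.
Arguments biproj2 {_} F X Y.
Arguments bipair {_} F {Z X Y} f g.

Lemma commAlg_ext (C : symMonCat) (X : C) (A B : commAlg X) :
  mul A = mul B -> one A = one B -> A = B.
Proof.
case: A => m u a1 a2 a3 a4; case: B => m' u' b1 b2 b3 b4 /= em eu; subst.
by congr CommAlg; exact: proof_irrelevance.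
Qed.

Section SymMonLemmas.
Variable C : symMonCat.
Implicit Types X Y Z W : C.

Lemma tensm_splitr X X' Y Y' (f : hom X X') (g : hom Y Y') :
  f ⊗₁ g = (idm X ⊗₁ g) ;; (f ⊗₁ idm Y').
Proof. by rewrite -tensm_comp comp_idl comp_idr. Qed.

Lemma tensm_compl X1 X2 X3 Y Y' (f : hom X1 X2) (f' : hom X2 X3) (g : hom Y Y') :
  (f ;; f') ⊗₁ g = (f ⊗₁ g) ;; (f' ⊗₁ idm Y').
Proof. by rewrite -tensm_comp comp_idr. Qed.

Lemma tensm_compr X X' Y1 Y2 Y3 (f : hom X X') (g : hom Y1 Y2) (g' : hom Y2 Y3) :
  f ⊗₁ (g ;; g') = (f ⊗₁ g) ;; (idm X' ⊗₁ g').
Proof. by rewrite -tensm_comp comp_idr. Qed.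

Lemma ascV_nat X X' Y Y' Z Z' (f : hom X X') (g : hom Y Y') (h : hom Z Z') :
  f ⊗₁ (g ⊗₁ h) ;; ascV X' Y' Z' = ascV X Y Z ;; f ⊗₁ g ⊗₁ h.
Proof.
rewrite -[LHS]comp_idl -(ascVK X Y Z) -!comp_assoc [asc _ _ _ ;; _]comp_assoc.
by rewrite -asc_nat -!comp_assoc ascK comp_idr.
Qed.

Lemma hexagonV X Y Z :
  sym (X ⊗ Y) Z ;; ascV Z X Y
    = asc X Y Z ;; (idm X ⊗₁ sym Y Z) ;; ascV X Z Y ;; (sym X Z ⊗₁ idm Y).
Proof.
pose u := asc Z X Y ;; sym Z (X ⊗ Y) ;; asc X Y Z.
pose v := ascV X Y Z ;; sym (X ⊗ Y) Z ;; ascV Z X Y.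
pose w := (idm X ⊗₁ sym Y Z) ;; ascV X Z Y ;; (sym X Z ⊗₁ idm Y).
have vu : v ;; u = idm _.
  rewrite /u /v -!comp_assoc [ascV Z X Y ;; _]comp_assoc ascVK comp_idl.
  by rewrite [sym _ Z ;; _]comp_assoc symK comp_idl ascVK.
have uw : u ;; w = idm _.
  rewrite /u /w hexagon -!comp_assoc [_ ;; (_ ⊗₁ sym Y Z ;; _)]comp_assoc.
  rewrite -tensm_comp comp_idl symK tensm_id comp_idl.
  rewrite [asc _ _ _ ;; _]comp_assoc ascK comp_idl -tensm_comp comp_idl symK.
  exact: tensm_id.
have -> : asc X Y Z ;; (idm X ⊗₁ sym Y Z) ;; ascV X Z Y ;; (sym X Z ⊗₁ idm Y)
    = asc X Y Z ;; w by rewrite /w !comp_assoc.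
have <- : v = w by rewrite -[v]comp_idr -uw comp_assoc vu comp_idl.
by rewrite /v !comp_assoc ascK comp_idl.
Qed.

Variables (X0 : C) (A : commAlg X0) (M : lmodule A).

Lemma act_mulV :
  (idm X0 ⊗₁ act M) ;; act M = ascV X0 X0 M ;; (mul A ⊗₁ idm M) ;; act M.
Proof. by rewrite -comp_assoc act_mul !comp_assoc ascVK comp_idl. Qed.

Definition ract : hom (M ⊗ X0) M := sym M X0 ;; act M.

Lemma act_ract :
  (act M ⊗₁ idm X0) ;; ract = asc X0 M X0 ;; (idm X0 ⊗₁ ract) ;; act M.
Proof.
rewrite /ract comp_assoc sym_nat -comp_assoc act_mulV !comp_assoc hexagonV.
rewrite -[_ ;; _ ;; mul A ⊗₁ _]comp_assoc -tensm_compl mul_comm tensm_compr.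
by rewrite -!comp_assoc act_mulV !comp_assoc.
Qed.

Lemma ract_mul :
  (ract ⊗₁ idm X0) ;; ract = asc M X0 X0 ;; (idm M ⊗₁ mul A) ;; ract.
Proof.
rewrite {1}/ract tensm_compl -comp_assoc act_ract /ract tensm_compr.
rewrite -!comp_assoc act_mulV !comp_assoc -hexagon.
rewrite -[_ ;; asc X0 X0 M ;; _]comp_assoc ascK comp_idr.
by rewrite -[asc _ _ _ ;; idm M ⊗₁ mul A ;; _]comp_assoc sym_nat !comp_assoc.
Qed.

End SymMonLemmas.

Section SquareZero.
Variables (C : addSMC) (F : finCoproducts C).
Variables (X : C) (A : commAlg X) (M : lmodule A).

Local Notation "'p₁'" := (biproj1 F X M).
Local Notation "'p₂'" := (biproj2 F X M).

Definition sqzero_mul :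
    hom (coprod F X M ⊗ coprod F X M) (coprod F X M) :=
  bipair F ((p₁ ⊗₁ p₁) ;; mul A)
         ((p₁ ⊗₁ p₂) ;; act M + sym _ _ ;; (p₁ ⊗₁ p₂) ;; act M).

Definition sqzero_one : hom unitob (coprod F X M) :=
  bipair F (one A) (zerom unitob M).

Let mul1 : sqzero_mul ;; p₁ = (p₁ ⊗₁ p₁) ;; mul A.
Proof. exact: bipair_proj1. Qed.

Let mul2 :
  sqzero_mul ;; p₂ = (p₁ ⊗₁ p₂) ;; act M + (p₂ ⊗₁ p₁) ;; ract M.
Proof. by rewrite /sqzero_mul bipair_proj2 /ract !comp_assoc sym_nat. Qed.

Lemma sqzero_assoc :
  (sqzero_mul ⊗₁ idm _) ;; sqzero_mul
    = asc _ _ _ ;; (idm _ ⊗₁ sqzero_mul) ;; sqzero_mul.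
Proof.
apply: bipair_ext; rewrite -!comp_assoc ?mul1 ?mul2.
  rewrite !comp_assoc -tensm_comp -[_ ;; _ ⊗₁ _]comp_assoc -tensm_comp.
  rewrite !comp_idl !mul1 tensm_compl tensm_compr -!comp_assoc mul_assoc.
  by rewrite !comp_assoc asc_nat.
rewrite !comp_addr !comp_assoc -!tensm_comp.
rewrite -![asc _ _ _ ;; _ ;; _]comp_assoc -!tensm_comp !comp_idl mul1 mul2.
rewrite tens_addl tens_addr !(comp_addl, comp_addr) -addm_assoc.
congr (_ + (_ + _)).
- by rewrite tensm_compl tensm_compr -!comp_assoc act_mul !comp_assoc asc_nat.
- by rewrite tensm_compl tensm_compr -!comp_assoc act_ract !comp_assoc asc_nat.
- by rewrite tensm_compl tensm_compr -!comp_assoc ract_mul !comp_assoc asc_nat.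
Qed.

Lemma sqzero_comm : sym _ _ ;; sqzero_mul = sqzero_mul.
Proof.
rewrite /sqzero_mul comp_bipair comp_assoc -sym_nat -comp_assoc mul_comm.
by rewrite comp_addr !comp_assoc symK comp_idl addm_comm.
Qed.

Lemma sqzero_onel : (sqzero_one ⊗₁ idm _) ;; sqzero_mul = lun _.
Proof.
apply: bipair_ext; rewrite -comp_assoc ?mul1 ?mul2 ?comp_addr !comp_assoc.
  rewrite -tensm_comp bipair_proj1 comp_idl.
  by rewrite tensm_splitr -comp_assoc mul_onel lun_nat.
rewrite -!tensm_comp bipair_proj1 bipair_proj2 !comp_idl tens_0l !comp_0l addm0.
by rewrite tensm_splitr -comp_assoc act_one lun_nat.
Qed.

Lemma sqzero_oner : (idm _ ⊗₁ sqzero_one) ;; sqzero_mul = run _.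
Proof.
by rewrite -sqzero_comm comp_assoc sym_nat -comp_assoc sqzero_onel sym_lun.
Qed.

Definition sqzero : commAlg (coprod F X M) :=
  CommAlg sqzero_assoc sqzero_onel sqzero_oner sqzero_comm.

End SquareZero.

Record talgebra (C : category) (S : monad C) (X : C) := TAlgebra {
  tact : hom (S X) X;
  tact_eta : eta S X ;; tact = idm X;
  tact_mu : mu S X ;; tact = Tm S tact ;; tact
}.

Section AssociatedAlgebra.
Variables (C : symMonCat) (S : algModality C) (X : C) (A : talgebra S X).

Local Notation α := (tact A).

Definition assoc_mul : hom (X ⊗ X) X :=
  (eta S X ⊗₁ eta S X) ;; mul (freeAlg S X) ;; α.

Definition assoc_one : hom unitob X := one (freeAlg S X) ;; α.

Lemma tact_mul : mul (freeAlg S X) ;; α = (α ⊗₁ α) ;; assoc_mul.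
Proof.
rewrite /assoc_mul !comp_assoc -tensm_comp !eta_nat tensm_comp.
rewrite -[_ ;; _ ;; mul _]comp_assoc -(proj1 (Tm_hom S α)).
rewrite -!comp_assoc -tact_mu [mul _ ;; (_ ;; _)]comp_assoc (proj1 (mu_hom S X)).
by rewrite !comp_assoc -tensm_comp !eta_mu tensm_id comp_idl.
Qed.

Lemma assoc_assoc :
  (assoc_mul ⊗₁ idm X) ;; assoc_mul
    = asc X X X ;; (idm X ⊗₁ assoc_mul) ;; assoc_mul.
Proof.
set m := mul (freeAlg S X); set h := eta S X.
have -> : assoc_mul ⊗₁ idm X = ((h ⊗₁ h ;; m) ⊗₁ h) ;; (α ⊗₁ α).
  by rewrite -tensm_comp tact_eta.
have -> : idm X ⊗₁ assoc_mul = (h ⊗₁ (h ⊗₁ h ;; m)) ;; (α ⊗₁ α).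
  by rewrite -tensm_comp tact_eta.
rewrite -!comp_assoc -tact_mul !comp_assoc -/m; congr (_ ;; α).
rewrite tensm_compl tensm_compr -comp_assoc mul_assoc.
by rewrite !comp_assoc asc_nat.
Qed.

Lemma assoc_onel : (assoc_one ⊗₁ idm X) ;; assoc_mul = lun X.
Proof.
have -> : assoc_one ⊗₁ idm X
    = (one (freeAlg S X) ⊗₁ eta S X) ;; (α ⊗₁ α).
  by rewrite -tensm_comp tact_eta.
rewrite -comp_assoc -tact_mul tensm_splitr comp_assoc.
rewrite -[_ ;; mul _]comp_assoc mul_onel lun_nat -comp_assoc tact_eta.
exact: comp_idr.
Qed.

Lemma assoc_comm : sym X X ;; assoc_mul = assoc_mul.
Proof.
rewrite /assoc_mul !comp_assoc -sym_nat -[_ ;; sym _ _ ;; _]comp_assoc.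
by rewrite mul_comm.
Qed.

Lemma assoc_oner : (idm X ⊗₁ assoc_one) ;; assoc_mul = run X.
Proof. by rewrite -assoc_comm comp_assoc sym_nat -comp_assoc assoc_onel sym_lun. Qed.

Definition assocAlg : commAlg X :=
  CommAlg assoc_assoc assoc_onel assoc_oner assoc_comm.

End AssociatedAlgebra.

Section W.
Variables (C : codiffCat) (F : finCoproducts C).

Local Notation S := (@modality C).

Variables (X : C) (A : talgebra S X) (M : lmodule (assocAlg A)).

Local Notation XM := (coprod F X M).
Local Notation "'p₁'" := (biproj1 F X M).
Local Notation "'p₂'" := (biproj2 F X M).

Definition W_act1 : hom (S XM) X := Tm S p₁ ;; tact A.

Definition W_act2 : hom (S XM) M :=
  der deriv XM ;; (Tm S p₁ ⊗₁ p₂) ;; (tact A ⊗₁ idm M) ;; act M.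

Definition W_act : hom (S XM) XM := bipair F W_act1 W_act2.

Let W_act2E : W_act2 = der deriv XM ;; (W_act1 ⊗₁ p₂) ;; act M.
Proof. by rewrite /W_act2 -[der _ _ ;; _ ;; _]comp_assoc -tensm_compl. Qed.

Lemma W_eta : eta S XM ;; W_act = idm XM.
Proof.
have e1 : eta S XM ;; W_act1 = p₁.
  by rewrite /W_act1 comp_assoc -eta_nat -comp_assoc tact_eta comp_idr.
apply: bipair_ext; rewrite -comp_assoc ?bipair_proj1 ?bipair_proj2 comp_idl //.
rewrite W_act2E !comp_assoc der_eta -[_ ;; (W_act1 ⊗₁ _)]comp_assoc -tensm_comp.
have -> : one (freeAlg S XM) ;; W_act1 = one (assocAlg A).
  by rewrite /W_act1 comp_assoc (proj2 (Tm_hom S p₁)).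
by rewrite tensm_splitr -!comp_assoc act_one lun_nat comp_assoc lunVK !comp_idl.
Qed.

Lemma W_mu : mu S XM ;; W_act = Tm S W_act ;; W_act.
Proof.
have e1 : mu S XM ;; W_act1 = Tm S W_act1 ;; tact A.
  by rewrite /W_act1 comp_assoc -mu_nat -comp_assoc tact_mu Tm_comp comp_assoc.
have e2 : Tm S W_act ;; W_act1 = mu S XM ;; W_act1.
  by rewrite e1 {2}/W_act1 comp_assoc -Tm_comp bipair_proj1.
have e3 : mul (freeAlg S XM) ;; W_act1
    = (W_act1 ⊗₁ W_act1) ;; mul (assocAlg A).
  rewrite /W_act1 comp_assoc (proj1 (Tm_hom S p₁)) tensm_comp -!comp_assoc.
  by rewrite tact_mul.
apply: bipair_ext; rewrite -!comp_assoc ?bipair_proj1 ?bipair_proj2 //.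
rewrite {2}W_act2E [RHS]comp_assoc [in RHS]comp_assoc der_nat.
rewrite -[_ ;; (W_act1 ⊗₁ _)]comp_assoc -tensm_comp e2 bipair_proj2.
rewrite !W_act2E !comp_assoc der_mu.
rewrite -[_ ;; (W_act1 ⊗₁ p₂)]comp_assoc -tensm_comp comp_idl e3.
rewrite tensm_compl -!comp_assoc act_mul !comp_assoc.
rewrite -[_ ;; ascV _ _ _ ;; _]comp_assoc -ascV_nat.
rewrite -!comp_assoc [ascV _ _ _ ;; _]comp_assoc ascVK comp_idl.
by rewrite -/W_act1 tensm_comp (tensm_compr W_act1) !comp_assoc.
Qed.

Definition W : talgebra S XM := TAlgebra W_eta W_mu.

End W.

(* Main.v *)
(* Both components of [W_act] behave well on products: the first is an algebra
   homomorphism, and by the Leibniz rule the second is a derivation along the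
   first.  Precomposing with [eta ⊗ eta], which turns the components of [W_act]
   into the projections, gives the multiplication of the square-zero extension. *)
Require Import Defs.
From mathcomp Require Import ssreflect ssrfun.

Set Implicit Arguments.
Unset Strict Implicit.
Unset Printing Implicit Defensive.

Section WActMul.
Variables (C : codiffCat) (F : finCoproducts C).

Local Notation S := (@modality C).

Variables (X : C) (A : talgebra S X) (M : lmodule (assocAlg A)).

Local Notation XM := (coprod F X M).
Local Notation "'p₁'" := (biproj1 F X M).
Local Notation "'p₂'" := (biproj2 F X M).
Local Notation w₁ := (W_act1 F M).
Local Notation w₂ := (W_act2 F M).

(** First component of the unit law [W_eta]; the next lemma is the second. *)
Lemma eta_W_act1 : eta S XM ;; w₁ = p₁.
Proof.
by rewrite -(bipair_proj1 F w₁ w₂) comp_assoc -/(W_act F M) W_eta comp_idl.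
Qed.

Lemma eta_W_act2 : eta S XM ;; w₂ = p₂.
Proof.
by rewrite -(bipair_proj2 F w₁ w₂) comp_assoc -/(W_act F M) W_eta comp_idl.
Qed.

Lemma W_act2E : w₂ = der deriv XM ;; (w₁ ⊗₁ p₂) ;; act M.
Proof. by rewrite /W_act2 -[der _ _ ;; _ ;; _]comp_assoc -tensm_compl. Qed.

Lemma mul_W_act1 :
  mul (freeAlg S XM) ;; w₁ = (w₁ ⊗₁ w₁) ;; mul (assocAlg A).
Proof.
rewrite /W_act1 comp_assoc (proj1 (Tm_hom S p₁)) tensm_comp -!comp_assoc.
by rewrite tact_mul.
Qed.

Lemma one_W_act1 : one (freeAlg S XM) ;; w₁ = one (assocAlg A).
Proof. by rewrite /W_act1 comp_assoc (proj2 (Tm_hom S p₁)). Qed.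

(** The deriving transform kills the unit. *)
Lemma one_W_act2 : one (freeAlg S XM) ;; w₂ = zerom _ _.
Proof. by rewrite W_act2E !comp_assoc der_one !comp_0l. Qed.

(** Both Leibniz summands end in this composite; it splits because [w₁] is multiplicative and the
    action is associative. *)
Let mul_act :
  ascV _ _ _ ;; (mul (freeAlg S XM) ⊗₁ idm XM) ;; (w₁ ⊗₁ p₂) ;; act M
    = (w₁ ⊗₁ (w₁ ⊗₁ p₂ ;; act M)) ;; act M.
Proof.
rewrite -[_ ;; _ ;; (w₁ ⊗₁ p₂)]comp_assoc -tensm_comp comp_idl mul_W_act1.
rewrite tensm_compl comp_assoc -ascV_nat tensm_compr.
by rewrite -!comp_assoc act_mulV !comp_assoc.
Qed.

Lemma mul_W_act2 :
  mul (freeAlg S XM) ;; w₂ = (w₁ ⊗₁ w₂) ;; act M + (w₂ ⊗₁ w₁) ;; ract M.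
Proof.
rewrite {1}W_act2E !comp_assoc der_mul !comp_addl; congr (_ + _).
  rewrite -!comp_assoc [ascV _ _ _ ;; _]comp_assoc.
  rewrite [ascV _ _ _ ;; _ ;; _]comp_assoc mul_act comp_assoc -tensm_comp.
  by rewrite comp_idl comp_assoc -W_act2E.
rewrite -!comp_assoc [ascV _ _ _ ;; _]comp_assoc.
rewrite [ascV _ _ _ ;; _ ;; _]comp_assoc mul_act.
(* The symmetry from the Leibniz rule slides past [w₁ ⊗₁ p₂] and turns [act] into [ract]. *)
rewrite [(idm _ ⊗₁ sym _ _) ;; _]comp_assoc -tensm_comp comp_idl.
rewrite [sym _ _ ;; _]comp_assoc -sym_nat -[_ ;; sym _ _ ;; _]comp_assoc.
rewrite -/(ract M) tensm_compr.
(* Left and right actions commute ([act_ract]), so the differentiated factor regroups into [w₂]. *)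
rewrite [asc _ _ _ ;; _]comp_assoc [asc _ _ _ ;; _]comp_assoc -asc_nat.
rewrite -!comp_assoc [asc _ _ _ ;; _]comp_assoc -act_ract !comp_assoc.
by rewrite -!tensm_comp comp_idl comp_idr -W_act2E.
Qed.

End WActMul.

Theorem proposition4p4 (C : codiffCat) (F : finCoproducts C) (X : C)
    (A : talgebra (@modality C) X) (M : lmodule (assocAlg A)) :
  assocAlg (W F M) = sqzero F M.
Proof.
(* By proof irrelevance only multiplication and unit need comparing. *)
apply: commAlg_ext; rewrite /= /assoc_mul /assoc_one /= /W_act comp_bipair.
  congr (bipair F _ _); rewrite -comp_assoc ?mul_W_act1 ?mul_W_act2.
    by rewrite comp_assoc -tensm_comp eta_W_act1.
  rewrite comp_addr !comp_assoc -!tensm_comp eta_W_act1 eta_W_act2.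
  by rewrite sym_nat.
by rewrite one_W_act1 one_W_act2.
Qed.
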